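(* For every positive integer $k$ there exists a finite $(2k+1)$-regular graph $G^{2k+1}$ with the following property: for every finite $(2k+1)$-regular graph $G$, $G$ is of class 1 if and only if $G$ and $G^{2k+1}$ have a tight product.
   Context: All graphs are finite, undirected, and may have multiple edges and loops. Degrees count multiple edges with multiplicity, and a loop contributes $2$ to the degree of its vertex; the neighbor set $N_G(v)$ is a multiset. A map $\phi:V(H)\to V(G)$ is a covering map if for every $v\in V(H)$, $\phi$ maps the multiset $N_H(v)$ one-to-one and onto the multiset $N_G(\phi(v))$. A graph $H$ is a tight product of graphs $G_1$ and $G_2$ if $V(H)=V(G_1)\times V(G_2)$ and both coordinate projections $V(H)\to V(G_1)$ and $V(H)\to V(G_2)$ are covering maps. A graph $G$ with maximum degree $\Delta(G)$ is of class 1 if its edge-chromatic number equals $\Delta(G)$. *)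

(* Defs.v *)
From mathcomp Require Import all_boot.

Set Implicit Arguments.
Unset Strict Implicit.
Unset Printing Implicit Defensive.

(* A finite undirected multigraph on V. The names src and tgt only label the two
   ends of an edge; every notion below is symmetric in them. Loops (src = tgt)
   and parallel edges are allowed. *)
Record mgraph (V : finType) := MGraph {
  edge : finType;
  src : edge -> V;
  tgt : edge -> V
}.

Arguments edge {V} _.
Arguments src {V} _ _.
Arguments tgt {V} _ _.

(* N_G(v) as a multiset, i.e. a sequence considered up to perm_eq. A parallel
   edge contributes its other end once more; a loop at v contributes v twice. *)
Definition nbhd (V : finType) (G : mgraph V) (v : V) : seq V :=
  [seq tgt G e | e <- enum (edge G) & src G e == v] ++
  [seq src G e | e <- enum (edge G) & tgt G e == v].

Definition degree (V : finType) (G : mgraph V) (v : V) : nat :=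
  size (nbhd G v).

Definition max_degree (V : finType) (G : mgraph V) : nat :=
  \max_(v : V) degree G v.

Definition regular (V : finType) (G : mgraph V) (d : nat) : Prop :=
  forall v : V, degree G v = d.

Definition covering_map (V W : finType) (H : mgraph V) (G : mgraph W)
    (phi : V -> W) : Prop :=
  forall v : V, perm_eq (map phi (nbhd H v)) (nbhd G (phi v)).

Definition is_tight_product (V1 V2 : finType) (G1 : mgraph V1) (G2 : mgraph V2)
    (H : mgraph (V1 * V2)%type) : Prop :=
  covering_map H G1 fst /\ covering_map H G2 snd.

Definition have_tight_product (V1 V2 : finType)
    (G1 : mgraph V1) (G2 : mgraph V2) : Prop :=
  exists H : mgraph (V1 * V2)%type, is_tight_product G1 G2 H.

Definition incident (V : finType) (G : mgraph V) (e : edge G) (v : V) : bool :=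
  (src G e == v) || (tgt G e == v).

(* A loop meets its vertex twice, hence conflicts with itself: a graph with a
   loop has no proper edge colouring. *)
Definition proper_edge_coloring (V : finType) (G : mgraph V) (n : nat)
    (c : edge G -> 'I_n) : Prop :=
  (forall e : edge G, src G e <> tgt G e) /\
  (forall (e f : edge G) (v : V),
     e <> f -> incident e v -> incident f v -> c e <> c f).

Definition edge_colorable (V : finType) (G : mgraph V) (n : nat) : Prop :=
  exists c : edge G -> 'I_n, proper_edge_coloring c.

(* Relational, because a graph with a loop has no edge-chromatic number. *)
Definition is_edge_chromatic_number (V : finType) (G : mgraph V) (n : nat) :
    Prop :=
  edge_colorable G n /\ (forall m : nat, edge_colorable G m -> n <= m).

Definition class1 (V : finType) (G : mgraph V) : Prop :=
  is_edge_chromatic_number G (max_degree G).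

(* Main.v *)
Require Import Defs.
From mathcomp Require Import all_boot zify.

Set Implicit Arguments.
Unset Strict Implicit.
Unset Printing Implicit Defensive.

(** With [d = 2k + 1], the universal graph is the star with centre [a] and
    leaves [b_1, ..., b_d], with [k] loops at every leaf.  In a tight product
    [H] of [G] and the star, let [P_i] be the matrix of the edges of [H]
    between the layers [a] and [b_i].  The covering conditions say that [P_i]
    is a permutation matrix, that the [P_i] sum to the adjacency matrix [A] of
    [G], and that [A - P_i^T] is the adjacency matrix of the layer [b_i].  Hence [P_i] is symmetric with even diagonal, i.e. a perfect
    matching of [G], and the [P_i] form a proper edge colouring.  Conversely,
    from a decomposition of [G] into perfect matchings [P_i], put [P_i] between
    the layers [a] and [b_i] and [A - P_i] inside the layer [b_i]. *)

(** * Adjacency matrix [mult] and counting in neighbourhoods *)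

Definition mult (V : finType) (G : mgraph V) (u v : V) : nat :=
  count_mem v (nbhd G u).

Definition edges_between (V : finType) (G : mgraph V) (u v : V) :
    {set edge G} :=
  [set e | ((src G e == u) && (tgt G e == v)) ||
           ((src G e == v) && (tgt G e == u))].

Lemma edges_betweenC (V : finType) (G : mgraph V) (u v : V) :
  edges_between G u v = edges_between G v u.
Proof. by apply/setP=> e; rewrite !inE orbC. Qed.

Lemma sum_andb_eq (T : finType) (b : bool) (x : T) :
  \sum_(i : T) (b && (x == i) : nat) = b.
Proof.
rewrite (bigD1 x) //= eqxx andbT big1 ?addn0 // => i.
by rewrite eq_sym => /negbTE ->; rewrite andbF.
Qed.

Lemma count_enum_sum (T : finType) (a : pred T) :
  count a (enum T) = \sum_(x : T) (a x : nat).
Proof.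
rewrite -sum1_count big_enum_cond /= big_mkcond.
by apply: eq_bigr => x _; case: (a x).
Qed.

Lemma count_nbhd (V : finType) (G : mgraph V) (v : V) (a : pred V) :
  count a (nbhd G v) =
  \sum_(e : edge G) ((src G e == v) && a (tgt G e)) +
  \sum_(e : edge G) ((tgt G e == v) && a (src G e)).
Proof.
rewrite /nbhd count_cat !count_map.
by congr (_ + _); rewrite count_filter count_enum_sum;
  apply: eq_bigr => e _ /=; rewrite andbC.
Qed.

Lemma degreeE (V : finType) (G : mgraph V) (v : V) :
  degree G v =
  \sum_(e : edge G) (src G e == v) + \sum_(e : edge G) (tgt G e == v).
Proof.
rewrite /degree -count_predT count_nbhd.
by congr (_ + _); apply: eq_bigr => e _; rewrite andbT.
Qed.

Lemma multC (V : finType) (G : mgraph V) (u v : V) : mult G u v = mult G v u.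
Proof.
rewrite /mult !count_nbhd addnC.
by congr (_ + _); apply: eq_bigr => e _; rewrite andbC.
Qed.

(** Each loop at [u] is counted once from either end, so the two sums agree. *)
Lemma odd_mult_diag (V : finType) (G : mgraph V) (u : V) :
  odd (mult G u u) = false.
Proof.
rewrite /mult count_nbhd; set s := \sum_e _.
have <- : s = \sum_(e : edge G) ((tgt G e == u) && pred1 u (src G e)).
  by apply: eq_bigr => e _; rewrite andbC.
by rewrite addnn odd_double.
Qed.

(** For distinct ends, an edge is counted in exactly one of the two sums of [mult]; a loop would be
    counted in both. *)
Lemma card_edges_between (V : finType) (G : mgraph V) (u v : V) :
  u != v -> #|edges_between G u v| = mult G u v.
Proof.
move=> neq_uv; rewrite /mult count_nbhd -big_split -sum1_card [LHS]big_mkcond.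
apply: eq_bigr => e _; rewrite inE /=.
have [->|] := eqVneq (src G e) u; rewrite ?(negbTE neq_uv) /= ?andbF ?orbF ?addn0.
  by case: eqP.
by rewrite andbC; case: (_ && _).
Qed.

Lemma count_mem_sum_fst (T U : finType) (x : T) (s : seq (T * U)) :
  count_mem x (map fst s) = \sum_(y : U) count_mem (x, y) s.
Proof.
rewrite count_map; elim: s => [|[x' y'] s IHs] /=; first by rewrite big1.
rewrite IHs big_split /= -[in LHS](sum_andb_eq (x' == x) y').
by congr (_ + _); apply: eq_bigr => y _; rewrite xpair_eqE.
Qed.

Lemma count_mem_sum_snd (T U : finType) (y : U) (s : seq (T * U)) :
  count_mem y (map snd s) = \sum_(x : T) count_mem (x, y) s.
Proof.
rewrite count_map; elim: s => [|[x' y'] s IHs] /=; first by rewrite big1.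
rewrite IHs big_split /= -[in LHS](sum_andb_eq (y' == y) x').
by congr (_ + _); apply: eq_bigr => x _; rewrite xpair_eqE andbC.
Qed.

Lemma sum_option (T : finType) (F : option T -> nat) :
  \sum_x F x = F None + \sum_i F (Some i).
Proof.
rewrite (bigD1 None) //=; congr (_ + _).
rewrite (reindex_omap Some id) /=; last by case.
by apply: eq_bigl => i; rewrite eqxx.
Qed.

(** Turns coverings into equations between multiplicities: fibre sums of the matrix of [H] are
    entries of that of [G]. *)
Lemma covering_mapP (V W : finType) (H : mgraph V) (G : mgraph W)
    (phi : V -> W) :
  (forall x w, count_mem w (map phi (nbhd H x)) = mult G (phi x) w) <->
  covering_map H G phi.
Proof.
split=> [eqH x | covH x w]; last by move/permP: (covH x) => ->.
by apply/allP=> w _ /=; apply/eqP.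
Qed.

(** * Class 1 for regular graphs; colour classes as perfect matchings *)

Section ClassOne.
Variables (V : finType) (G : mgraph V).

Lemma degree_incident v : (forall e : edge G, src G e <> tgt G e) ->
  degree G v = #|[set e : edge G | incident e v]|.
Proof.
move=> loopless; rewrite degreeE -big_split -sum1_card [RHS]big_mkcond.
apply: eq_bigr => e _; rewrite inE /incident /=.
have := loopless e; case: eqP => [->|_]; last by case: eqP.
by case: eqP => // ->.
Qed.

Lemma edge_colorable_max_degree n : edge_colorable G n -> max_degree G <= n.
Proof.
case=> c [loopless proper]; apply/bigmax_leqP=> v _.
rewrite degree_incident // -(card_ord n) -(@card_in_imset _ _ c) ?max_card //.
move=> e f; rewrite !inE => ev fv cef; apply/eqP/negPn/negP=> /eqP nef.
exact: proper nef ev fv cef.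
Qed.

Lemma regular_class1 d : regular G d -> class1 G <-> edge_colorable G d.
Proof.
move=> regG; have [v _ | V0] := pickP (fun _ : V => true).
  have maxG : max_degree G = d.
    apply/eqP; rewrite eqn_leq; apply/andP; split.
      by apply/bigmax_leqP=> w _; rewrite regG.
    by rewrite -(regG v); apply: leq_bigmax.
  rewrite /class1 maxG; split=> [[]//|colG]; split=> // m colm.
  by rewrite -maxG; apply: edge_colorable_max_degree.
(* Without vertices the maximum degree is 0 rather than [d], but there are no edges to colour. *)
have noE (e : edge G) : False by have := V0 (src G e).
split=> _; last split.
- exists (fun e => False_rect _ (noE e)); split=> [e | e]; by case: (noE e).
- exists (fun e => False_rect _ (noE e)); split=> [e | e]; by case: (noE e).
- by move=> m _; rewrite /max_degree big_pred0.
Qed.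

(** Each of the [d] colours occurs at most once at [v], and the occurrences add up to the degree
    [d], so no colour is missing. *)
Lemma proper_coloring_perfect d (c : edge G -> 'I_d) (v : V) (j : 'I_d) :
  regular G d -> proper_edge_coloring c ->
  \sum_(e : edge G) ((src G e == v) && (c e == j)) +
  \sum_(e : edge G) ((tgt G e == v) && (c e == j)) = 1.
Proof.
move=> regG [loopless proper].
pose h i := \sum_(e : edge G) ((src G e == v) && (c e == i)) +
  \sum_(e : edge G) ((tgt G e == v) && (c e == i)).
have h1 i : h i <= 1.
  have -> : h i = #|[set e : edge G | incident e v & c e == i]|.
    rewrite /h -big_split -sum1_card [RHS]big_mkcond.
    apply: eq_bigr => e _; rewrite inE /incident /=.
    have := loopless e; case: (c e == i); rewrite ?andbF ?andbT //.
    case: eqP => [->|_]; last by case: eqP.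
    by case: eqP => // ->.
  apply/card_le1_eqP=> e f; rewrite !inE => /andP[ev /eqP ce] /andP[fv /eqP cf].
  apply/eqP/negPn/negP=> /eqP nef.
  by apply: proper nef fv ev _; rewrite ce cf.
have sumh : \sum_i h i = d.
  rewrite -[RHS](regG v) degreeE big_split /= exchange_big.
  rewrite [X in _ + X]exchange_big.
  by congr (_ + _); apply: eq_bigr => e _; rewrite sum_andb_eq.
change (h j = 1); apply/eqP; rewrite eqn_leq h1 /= lt0n.
apply/negP=> /eqP hj0.
have := sumh; rewrite (bigD1 j) //= hj0 add0n => sumj.
have : \sum_(i | i != j) h i <= \sum_(i | i != j) 1 by apply: leq_sum.
rewrite sumj sum1_card cardC1 card_ord.
by have := ltn_ord j; lia.
Qed.

End ClassOne.

(** * The universal graph *)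

(** [None] is the centre and [Some i] a leaf; [inl i] is the spoke to leaf [i], and the pairs
    [inr (i, l)] are its [k] loops. *)
Definition looped_star (d k : nat) : mgraph (option 'I_d) :=
  @MGraph (option 'I_d) ('I_d + 'I_d * 'I_k)%type
    (fun e => match e with inl _ => None | inr p => Some p.1 end)
    (fun e => match e with inl i => Some i | inr p => Some p.1 end).

Lemma mult_looped_star d k (x y : option 'I_d) :
  mult (looped_star d k) x y =
  match x, y with
  | None, None => 0
  | Some i, Some j => (i == j) * k.*2
  | _, _ => 1
  end.
Proof.
have sum_pairs (b : 'I_d -> bool) :
    \sum_(p : 'I_d * 'I_k) (b p.1 : nat) = (\sum_i b i) * k.
  rewrite -(pair_bigA _ (fun i _ => b i : nat)) /= big_distrl.
  by apply: eq_bigr => i _; rewrite sum_nat_const card_ord mulnC.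
have sum1 (i : 'I_d) : \sum_(j : 'I_d) (j == i : nat) = 1.
  rewrite -[RHS](sum_andb_eq true i).
  by apply: eq_bigr => j _; rewrite eq_sym.
rewrite /mult count_nbhd !big_sumType /=.
case: x y => [i|] [j|] /=.
- have -> : \sum_(p : 'I_d * 'I_k) ((Some p.1 == Some i) && (Some p.1 == Some j))
      = (i == j) * k.
    rewrite (sum_pairs (fun l => (l == i) && (l == j))); congr (_ * _).
    rewrite -[RHS](sum_andb_eq _ i); apply: eq_bigr => l _.
    by rewrite [l == i]eq_sym; case: eqP => [->|]; rewrite ?andbT ?andbF.
  rewrite !big1 => [|l _|l _]; rewrite ?andbF //.
  by rewrite !add0n -mulnDr addnn.
- rewrite [X in X + _ + _]big1 // [X in _ + X + _]big1 => [|p _]; rewrite ?andbF //.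
  rewrite [X in _ + (_ + X)]big1 => [|p _]; rewrite ?andbF // !add0n addn0.
  by rewrite -[RHS](sum1 i); apply: eq_bigr => l _; rewrite andbT.
- rewrite [X in _ + X + _]big1 // [X in _ + (_ + X)]big1 //.
  by rewrite [X in _ + (X + _)]big1 // !addn0; apply: sum1.
- by rewrite !big1.
Qed.

Lemma regular_looped_star d k : d = k.*2.+1 -> regular (looped_star d k) d.
Proof.
move=> dE v; rewrite degreeE !big_sumType /=; subst d.
have sum1 (i : 'I_k.*2.+1) : \sum_(j < k.*2.+1) (Some j == Some i : nat) = 1.
  rewrite -[RHS](sum_andb_eq true i).
  by apply: eq_bigr => j _; rewrite eq_sym.
case: v => [i|] /=.
  rewrite sum1 [X in X + _ + _]big1 //.
  have -> : \sum_(p : 'I_k.*2.+1 * 'I_k) (Some p.1 == Some i : nat) = k.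
    rewrite -(pair_bigA _ (fun j _ => Some j == Some i : nat)) /= exchange_big /=.
    by under eq_bigr do rewrite sum1; rewrite sum1_card card_ord.
  by lia.
rewrite sum1_card card_ord !big1 //; lia.
Qed.

(** * From a tight product to an edge colouring *)

Section Colouring.
Variables (V : finType) (G : mgraph V) (d k : nat).
Variable H : mgraph (V * option 'I_d)%type.
Hypothesis tightH : is_tight_product G (looped_star d k) H.
Hypothesis d_gt0 : 0 < d.

(** The matrix [P_i]: rows in the layer of the centre, columns in the layer of leaf [i]. *)
Let matching (i : 'I_d) u v := mult H (u, None) (v, Some i).

Let mult_fst x v : mult G x.1 v = \sum_w mult H x (v, w).
Proof.
by case: tightH => /covering_mapP <- _; rewrite count_mem_sum_fst.
Qed.

Let mult_snd x w : mult (looped_star d k) x.2 w = \sum_v mult H x (v, w).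
Proof.
by case: tightH => _ /covering_mapP <-; rewrite count_mem_sum_snd.
Qed.

Let mult_eq0 u v x y :
  mult (looped_star d k) x y = 0 -> mult H (u, x) (v, y) = 0.
Proof.
move=> xy0; have /eqP := mult_snd (u, x) y.
rewrite /= xy0 eq_sym sum_nat_eq0 => /forallP/(_ v).
by move/implyP/(_ isT)/eqP.
Qed.

Let sum_matching i u : \sum_v matching i u v = 1.
Proof. by rewrite -mult_snd mult_looped_star. Qed.

Let mult_matching u v : mult G u v = \sum_i matching i u v.
Proof.
by rewrite (mult_fst (u, None)) sum_option mult_eq0 ?mult_looped_star.
Qed.

(** Leaf [i] is adjacent only to the centre and itself, so only two blocks survive; the block
    towards the centre is [P_i] transposed. *)
Let mult_layer i u v :
  mult G u v = matching i v u + mult H (u, Some i) (v, Some i).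
Proof.
rewrite (mult_fst (u, Some i)) sum_option /matching multC; congr (_ + _).
rewrite (bigD1 i) //= big1 ?addn0 // => j neq_ji.
by rewrite mult_eq0 // mult_looped_star eq_sym (negbTE neq_ji).
Qed.

(** In [mult_layer] both multiplicities are symmetric in [u] and [v]; comparing it with its
    transpose and cancelling leaves [P_i] equal to its transpose. *)
Let matchingC i u v : matching i u v = matching i v u.
Proof.
have := mult_layer i u v; have := mult_layer i v u.
by rewrite (multC G v) (multC H (v, _)) => -> /addIn.
Qed.

Let matching_le1 i u v : matching i u v <= 1.
Proof. by rewrite -(sum_matching i u) (bigD1 v) //= leq_addr. Qed.

(** By [mult_layer] the entry is a difference of two even diagonal entries, hence even, and it is at
    most 1. *)
Let matching_diag i u : matching i u u = 0.
Proof.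
have := congr1 odd (mult_layer i u u); rewrite oddD !odd_mult_diag addbF.
by have := matching_le1 i u u; case: (matching i u u) => [|[]].
Qed.

Let matching_inj i u v w : 0 < matching i u v -> 0 < matching i u w -> v = w.
Proof.
move=> uv uw; apply/eqP/negPn/negP=> neq_vw.
have := sum_matching i u.
by rewrite (bigD1 v) //= (bigD1 w) 1?eq_sym //=; lia.
Qed.

Let colors u v := [set i | 0 < matching i u v].

Let colorsC u v : colors u v = colors v u.
Proof. by apply/setP=> i; rewrite !inE matchingC. Qed.

Let mult_diag u : mult G u u = 0.
Proof. by rewrite mult_matching big1. Qed.

Let loopless (e : edge G) : src G e <> tgt G e.
Proof.
move=> st; have := mult_diag (src G e); rewrite /mult count_nbhd.
by rewrite (bigD1 e) //= -st eqxx.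
Qed.

(** The matchings have entries 0 and 1 and sum to [mult G], so there are exactly enough colours for
    the parallel edges. *)
Let card_colors u v : u != v -> #|edges_between G u v| = #|colors u v|.
Proof.
move=> neq_uv; rewrite card_edges_between // mult_matching.
rewrite -sum1_card [RHS]big_mkcond; apply: eq_bigr => i _; rewrite inE.
by have := matching_le1 i u v; case: (matching i u v) => [|[]].
Qed.

(* Parallel edges between [u] and [v] receive the colours of the matchings
   containing [uv] in the order of enumeration. *)
Let color (e : edge G) : 'I_d :=
  nth (Ordinal d_gt0) (enum (colors (src G e) (tgt G e)))
      (index e (enum (edges_between G (src G e) (tgt G e)))).

(** Frees [color] from the orientation of [e], as both enumerated sets are symmetric in the ends. *)
Let color_between e u v : e \in edges_between G u v ->
  color e = nth (Ordinal d_gt0) (enum (colors u v))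
                (index e (enum (edges_between G u v))).
Proof.
rewrite inE /color => /orP[] /andP[/eqP -> /eqP ->] //.
by rewrite colorsC edges_betweenC.
Qed.

Let neq_between e u v : e \in edges_between G u v -> u != v.
Proof.
rewrite inE => /orP[] /andP[/eqP <- /eqP <-]; apply/eqP; first exact: loopless.
by move=> ts; apply: (loopless (e := e)).
Qed.

(** By [card_colors] the index is in range, so the default [Ordinal d_gt0] in [color] is never
    returned. *)
Let index_between e u v : e \in edges_between G u v ->
  index e (enum (edges_between G u v)) < size (enum (colors u v)).
Proof.
move=> euv; rewrite -cardE -card_colors ?(neq_between euv) // cardE.
by rewrite index_mem mem_enum.
Qed.

Let color_mem e u v : e \in edges_between G u v -> 0 < matching (color e) u v.
Proof.
move=> euv; rewrite (color_between euv).
have := mem_nth (Ordinal d_gt0) (index_between euv).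
by rewrite mem_enum inE.
Qed.

Let incident_between e u : incident e u -> exists v, e \in edges_between G u v.
Proof.
case/orP=> /eqP <-; [exists (tgt G e) | exists (src G e)];
  by rewrite inE !eqxx ?orbT.
Qed.

Lemma tight_product_edge_colorable : edge_colorable G d.
Proof.
exists color; split=> [|e f u nef]; first exact: loopless.
move=> /incident_between[v euv] /incident_between[w fuw] cef.
(* The matching of the common colour gives [u] a single partner, so [e] and [f] are parallel. *)
have vw : v = w.
  apply: (@matching_inj (color e) u); first exact: color_mem.
  by rewrite cef; apply: color_mem.
rewrite -{}vw in fuw; move: cef; rewrite (color_between euv) (color_between fuw).
(* The list of colours has no duplicates, so equal colours force equal positions and then equal
   edges. *)
move/eqP; rewrite nth_uniq ?enum_uniq ?index_between // => /eqP eq_ind.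
apply: nef; rewrite -(nth_index e (s := enum (edges_between G u v)) (x := e)).
  by rewrite eq_ind nth_index ?mem_enum.
by rewrite mem_enum.
Qed.

End Colouring.

(** * From an edge colouring to a tight product *)

Section TightProduct.
Variables (V : finType) (G : mgraph V) (k : nat).
Let d := k.*2.+1.
Variable c : edge G -> 'I_d.
Hypotheses (regG : regular G d) (properc : proper_edge_coloring c).

(** The involution on the star's vertices that swaps the centre with leaf [c e] and fixes the other
    leaves. *)
Let partner (e : edge G) (x : option 'I_d) : option 'I_d :=
  if x is Some j then (if c e == j then None else Some j) else Some (c e).

Let partnerK e : involutive (partner e).
Proof.
by case=> [j|] /=; rewrite ?eqxx //; case: eqP => [<-|/eqP/negbTE /= ->].
Qed.

(** Each edge [e] has one lift per layer [x], ending in layer [partner e x]: colour [i] joins the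
    centre's layer to that of leaf [i], all other colours stay inside the latter. *)
Let H : mgraph (V * option 'I_d)%type :=
  @MGraph (V * option 'I_d)%type (edge G * option 'I_d)%type
    (fun p => (src G p.1, p.2)) (fun p => (tgt G p.1, partner p.1 p.2)).

(** As [partner e] is an involution, the lift of [e] whose target lies in layer [x] starts in layer
    [partner e x], so both ends are treated alike. *)
Let count_nbhd_lift (u : V) (x : option 'I_d) (a : pred (V * option 'I_d)) :
  count a (nbhd H (u, x)) =
  \sum_(e : edge G) ((src G e == u) && a (tgt G e, partner e x)) +
  \sum_(e : edge G) ((tgt G e == u) && a (src G e, partner e x)).
Proof.
rewrite count_nbhd -(pair_bigA _ (fun e y =>
  ((src G e, y) == (u, x)) && a (tgt G e, partner e y) : nat)) /=.
rewrite -(pair_bigA _ (fun e y =>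
  ((tgt G e, partner e y) == (u, x)) && a (src G e, y) : nat)) /=.
congr (_ + _); apply: eq_bigr => e _.
  rewrite -[RHS](sum_andb_eq _ x); apply: eq_bigr => y _.
  by rewrite xpair_eqE [y == x]eq_sym; case: (x =P y) => [->|];
    rewrite ?andbT ?andbF.
rewrite -[RHS](sum_andb_eq _ (partner e x)); apply: eq_bigr => y _.
rewrite xpair_eqE (inv_eq (@partnerK e)) [y == _]eq_sym.
by case: (partner e x =P y) => [->|]; rewrite ?andbT ?andbF.
Qed.

Lemma edge_coloring_tight_product : have_tight_product G (looped_star d k).
Proof.
exists H; split; apply/covering_mapP=> [[u x]] w; rewrite count_map count_nbhd_lift.
  by rewrite /mult count_nbhd.
rewrite mult_looped_star /=.
have perfect j := proper_coloring_perfect u j regG properc.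
case: x w => [i|] [j|] /=; last by rewrite !big1 // => e _; rewrite andbF.
- have [<-|neq_ij] := eqVneq i j; last first.
    have neq_partner e : ((if c e == i then None else Some i) == Some j) = false.
      by case: ifP => // _; apply/negbTE.
    by rewrite !big1 // => e _; rewrite neq_partner andbF.
  (* The edges at [u] not coloured [i] remain in layer [i]. Adding the single edge of colour [i]
     completes the degree [k.*2.+1], so [k.*2] of them remain. *)
  apply: (@addIn 1); rewrite -[X in _ + X = _](perfect i) mul1n addn1 -/d.
  rewrite -[RHS](regG u) degreeE addnACA.
  by congr (_ + _); rewrite -big_split; apply: eq_bigr => e _ /=;
    case: (c e == i); rewrite ?eqxx ?andbT ?andbF ?addn0.
- rewrite -[RHS](perfect i).
  by congr (_ + _); apply: eq_bigr => e _; case: (c e == i).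
- exact: perfect.
Qed.

End TightProduct.

Theorem theorem1 (k : nat) (hk : 0 < k) :
  exists (W : finType) (K : mgraph W),
    regular K (2 * k + 1) /\
    forall (V : finType) (G : mgraph V),
      regular G (2 * k + 1) ->
      (class1 G <-> have_tight_product G K).
Proof.
have -> : 2 * k + 1 = k.*2.+1 by lia.
exists (option 'I_k.*2.+1), (looped_star k.*2.+1 k).
split=> [|V G regG]; first exact: regular_looped_star.
rewrite (regular_class1 regG); split=> [[c properc] | [H tightH]].
  exact: edge_coloring_tight_product properc.
exact: tight_product_edge_colorable tightH _.
Qed.
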